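(* There exist bitopological spaces $(X,\tau^{+},\tau^{-})$ for which antisymmetric components are strictly larger than symmetric components (i.e. the antisymmetric component of a point strictly contains its symmetric component).
   Context: A bitopological space $(X,\tau^{+},\tau^{-})$ is a set with two topologies; $\tau^\vee=\tau^{+}\vee\tau^{-}$ denotes the join topology, i.e. the coarsest topology containing both. $(X,\tau^{+},\tau^{-})$ is antisymmetrically connected if there do not exist nonempty subsets $A,B\subseteq X$ with $X=A\cup B$, $A\cap B=\varnothing$, $A$ $\tau^{+}$-open and $B$ $\tau^{-}$-open. A subset $C\subseteq X$ is antisymmetrically connected if it is so with the subspace topologies induced by $\tau^{+}$ and $\tau^{-}$. The symmetric component of $x$ is the connected component of $x$ in $(X,\tau^\vee)$. The antisymmetric component of $x$ is the maximal antisymmetrically connected subset of $X$ containing $x$. *)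

(* Defs.v *)
From HB Require Import structures.
From mathcomp Require Import all_boot all_classical topology.

Set Implicit Arguments.
Unset Strict Implicit.
Unset Printing Implicit Defensive.

Local Open Scope classical_set_scope.

(* The two topologies are plain values of the structure type [Topological],
   not canonical instances, so that one carrier can bear both. *)
Record bitopologicalType := Bitopological {
  bitop_sort :> choiceType;
  tau_pos : Topological bitop_sort;
  tau_neg : Topological bitop_sort }.

Section Bitopological.
Variable X : bitopologicalType.
Implicit Types (A B C D : set X) (x : X).

Definition pos_open : set_system X := @open (Topological.Pack (tau_pos X)).
Definition neg_open : set_system X := @open (Topological.Pack (tau_neg X)).

Definition join_space : topologicalType :=
  sup_topology (fun b : bool => if b then tau_pos X else tau_neg X).

Definition symmetric_component x : set X :=
  @connected_component join_space [set: X] x.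

Definition antisym_separation C A B :=
  [/\ A !=set0, B !=set0, C = A `|` B & A `&` B = set0] /\
  (exists2 U, pos_open U & A = C `&` U) /\
  (exists2 V, neg_open V & B = C `&` V).

Definition antisym_connected C := ~ exists A B, antisym_separation C A B.

Definition is_antisymmetric_component x C :=
  [/\ C x, antisym_connected C &
      forall D, D x -> antisym_connected D -> C `<=` D -> D = C].

Lemma antisym_connected_setT :
  antisym_connected [set: X] <->
  ~ exists A B, [/\ A !=set0, B !=set0, [set: X] = A `|` B & A `&` B = set0] /\
                pos_open A /\ neg_open B.
Proof.
split=> con [A [B [AB [oA oB]]]]; apply: con; exists A, B; split=> //.
  by split; [exists A | exists B]; rewrite ?setTI.
by move: oA oB => [U oU ->] [V oV ->]; rewrite !setTI.
Qed.

Lemma antisym_connectedU C D x : C x -> D x ->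
  antisym_connected C -> antisym_connected D -> antisym_connected (C `|` D).
Proof.
move=> Cx Dx cC cD [A [B [[[a Aa] [b Bb] CDE AB0] [[U oU AU] [V oV BV]]]]].
have sep E : E `<=` C `|` D -> antisym_connected E ->
    ~ ((E `&` A) !=set0 /\ (E `&` B) !=set0).
  move=> /setIidPl ECD cE [EA EB]; apply: cE; exists (E `&` A), (E `&` B); split.
    split=> //; last by rewrite setIACA AB0 setI0.
    by rewrite -setIUr -CDE ECD.
  by split; [exists U|exists V]; rewrite // ?AU ?BV setIA ECD.
have sC := sep C (@subsetUl _ C D) cC; have sD := sep D (@subsetUr _ C D) cD.
have CDa : (C `|` D) a by rewrite CDE; left.
have CDb : (C `|` D) b by rewrite CDE; right.
have : (A `|` B) x by rewrite -CDE; left.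
case=> [Ax|Bx].
  by case: CDb => ?; [apply: sC|apply: sD]; split; [exists x|exists b|exists x|exists b].
by case: CDa => ?; [apply: sC|apply: sD]; split; [exists a|exists x|exists a|exists x].
Qed.

Lemma is_antisymmetric_component_uniq x C D :
  is_antisymmetric_component x C -> is_antisymmetric_component x D -> C = D.
Proof.
move=> [Cx cC maxC] [Dx cD maxD].
have cCD := antisym_connectedU Cx Dx cC cD.
have CDx : (C `|` D) x by left.
by rewrite -(maxC _ CDx cCD (@subsetUl _ _ _)) (maxD _ CDx cCD (@subsetUr _ _ _)).
Qed.

End Bitopological.

(* Main.v *)
(** On [bool], take the discrete topology for [tau_pos] and the indiscrete one
    for [tau_neg].  The join is discrete, so symmetric components are
    singletons; but the only nonempty [tau_neg]-open set is the whole space, so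
    the space is antisymmetrically connected. *)
Require Import Defs.
From mathcomp Require Import all_boot all_classical topology.

Local Open Scope classical_set_scope.

(** The neighbourhood filter of a point in the join converges to it in each factor; index [true]
    selects [tau_pos]. *)
Lemma pos_open_join (X : bitopologicalType) (U : set X) :
  pos_open U -> @open (join_space X) U.
Proof.
move=> oU; rewrite openE => t Ut.
have /cvg_sup/(_ true) := @cvg_id _ (@nbhs _ (join_space X) t).
by apply; apply: open_nbhs_nbhs.
Qed.

Lemma symmetric_component_pos_discrete (X : bitopologicalType) (x : X) :
  (forall U : set X, pos_open U) -> symmetric_component x = [set x].
Proof.
move=> discr; apply/seteqP; split=> [y [A [Ax _ cA] Ay]|_ ->]; last first.
  exact: (@connected_component_refl (join_space X)).
(* [[set x]] is clopen in the join, so its trace on the connected set [A], nonempty since it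
   contains [x], is all of [A]. *)
have sAx : A `&` [set x] = A.
  apply: cA; first by exists x.
    by exists [set x] => //; apply: pos_open_join.
  exists [set x] => //; rewrite -openC; exact: pos_open_join.
by move: Ay; rewrite -sAx => -[].
Qed.

Lemma antisym_connectedT_neg_indiscrete (X : bitopologicalType) :
  (forall V : set X, neg_open V -> V !=set0 -> V = setT) ->
  antisym_connected [set: X].
Proof.
move=> indiscr; apply/antisym_connected_setT.
move=> [A [B [[[a Aa] B0 _ AB0] [_ oB]]]].
suff : (A `&` B) a by rewrite AB0.
by rewrite (indiscr B oB B0).
Qed.

Lemma is_antisymmetric_componentT {X : bitopologicalType} (x : X) :
  antisym_connected [set: X] -> is_antisymmetric_component x setT.
Proof. by split=> // D _ _; rewrite subTset. Qed.

(** The initial topology of a constant map is indiscrete: a preimage under it is empty or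
    everything. *)
Definition discrete_indiscrete_bool : bitopologicalType :=
  @Bitopological bool (Topological.class bool)
    (Topological.class (initial_topology (fun _ : bool => true))).

Lemma discrete_indiscrete_bool_pos_open (U : set discrete_indiscrete_bool) :
  pos_open U.
Proof. exact: (@discrete_open bool). Qed.

Lemma discrete_indiscrete_bool_neg_open (V : set discrete_indiscrete_bool) :
  neg_open V -> V !=set0 -> V = setT.
Proof.
move=> oV; have [W _ <-] : wopen (fun _ : bool => true) V := oV.
by case=> v Wv; apply/seteqP; split=> // w _; exact: Wv.
Qed.

Theorem proposition5p9 :
  exists X : bitopologicalType,
    [set: X] !=set0 /\
    forall x : X, exists2 C : set X,
      is_antisymmetric_component x C & symmetric_component x `<` C.
Proof.
exists discrete_indiscrete_bool; split; first by exists true.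
move=> x; exists setT.
  apply/is_antisymmetric_componentT/antisym_connectedT_neg_indiscrete.
  exact: discrete_indiscrete_bool_neg_open.
rewrite symmetric_component_pos_discrete; last first.
  exact: discrete_indiscrete_bool_pos_open.
(* [negb x] witnesses strictness: it lies outside [[set x]]. *)
split=> // /(_ (negb x) I); by case: x.
Qed.
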